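(* Consider a sequence (indexed by $n\to\infty$) of attributed Erdős–Rényi pairs $(G_1,G_2)\sim\mathcal{G}(n,\bm p;m,\bm q)$, where $m$, $\bm p$, $\bm q$ may depend on $n$, and let $G=G_1\wedge G_2$ be the intersection graph. (i) If $$-n\log(1-2p_{11}+2p_{11}^2)-m\log(1-2q_{11}+2q_{11}^2)-2\log n\to-\infty,$$ then with high probability (probability tending to $1$ as $n\to\infty$) there exists at least one pair of indistinguishable user vertices in $G$. (ii) Conversely, if $$-n\log(1-2p_{11}+2p_{11}^2)-m\log(1-2q_{11}+2q_{11}^2)-2\log n\to\infty,$$ then with high probability there exists no pair of indistinguishable user vertices in $G$.
   Context: Attributed Erdős–Rényi pair $\mathcal{G}(n,\bm p;m,\bm q)$: two random graphs $G_1,G_2$ on a common vertex set $\mathcal V=\mathcal V_{\mathrm u}\cup\mathcal V_{\mathrm a}$ consisting of $n$ user vertices $\mathcal V_{\mathrm u}=[n]$ and $m$ attribute vertices $\mathcal V_{\mathrm a}$ (disjoint from $\mathcal V_{\mathrm u}$). Let $\mathcal E_{\mathrm u}$ be the set of (unordered) pairs of distinct users and $\mathcal E_{\mathrm a}=\mathcal V_{\mathrm u}\times\mathcal V_{\mathrm a}$; there are no edges between attribute vertices. $G_k(e)\in\{0,1\}$ indicates whether $e$ is an edge of $G_k$. Independently over $e\in\mathcal E_{\mathrm u}\cup\mathcal E_{\mathrm a}$, $\mathsf P((G_1(e),G_2(e))=(a,b))=p_{ab}$ for $e\in\mathcal E_{\mathrm u}$ and $=q_{ab}$ for $e\in\mathcal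 E_{\mathrm a}$ ($a,b\in\{0,1\}$), where $\bm p=(p_{11},p_{10},p_{01},p_{00})$ and $\bm q=(q_{11},q_{10},q_{01},q_{00})$ are probability vectors. Standing assumption: $G_1(e)$ and $G_2(e)$ are positively correlated for every $e$ (correlation coefficient defined and $>0$). The intersection graph $G_1\wedge G_2$ is the graph on $\mathcal V$ whose edge set is the intersection of the edge sets of $G_1$ and $G_2$. Two distinct user vertices $i,j$ are indistinguishable in $G=G_1\wedge G_2$ if $G((i,v))=G((j,v))$ for all $v\in\mathcal V\setminus\{i,j\}$. *)

(* Defs.v *)
From HB Require Import structures.
From mathcomp Require Import all_boot all_order all_algebra.
From mathcomp Require Import all_classical all_reals all_analysis.
Set Implicit Arguments.
Unset Strict Implicit.
Unset Printing Implicit Defensive.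
Import Order.TTheory GRing.Theory Num.Theory numFieldNormedType.Exports.
Local Open Scope classical_set_scope.
Local Open Scope ring_scope.

Definition vertex (n m : nat) : finType := ('I_n + 'I_m)%type.

Definition user (n m : nat) (i : 'I_n) : vertex n m := inl i.
Definition attribute (n m : nat) (a : 'I_m) : vertex n m := inr a.

(* A graph is its edge set, an edge being an unordered pair [set x; y].
   The pairs (i, a) of users and attributes are also written unordered, which
   is unambiguous since users and attributes are disjoint. *)
Definition graph (n m : nat) : finType := {set {set vertex n m}}.

Definition user_pairs (n m : nat) : {set {set vertex n m}} :=
  [set e | [exists i : 'I_n, exists j : 'I_n,
             (i != j) && (e == [set user m i; user m j])]]%SET.

Definition user_attribute_pairs (n m : nat) : {set {set vertex n m}} :=
  [set e | [exists i : 'I_n, exists a : 'I_m,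
             e == [set user m i; attribute n a]]]%SET.

Definition attributed_graph (n m : nat) (G : graph n m) : bool :=
  G \subset user_pairs n m :|: user_attribute_pairs n m.

Definition intersection_graph (n m : nat) (G1 G2 : graph n m) : graph n m :=
  G1 :&: G2.

Definition indistinguishable (n m : nat) (G : graph n m) (i j : 'I_n) : Prop :=
  forall v : vertex n m, v != user m i -> v != user m j ->
    ([set user m i; v]%SET \in G) = ([set user m j; v]%SET \in G).

Definition has_indistinguishable_users (n m : nat) (G : graph n m) : Prop :=
  exists i j : 'I_n, i != j /\ indistinguishable G i j.

Definition mutually_independent d d' (T : measurableType d)
    (U : measurableType d') (R : realType) (P : probability T R)
    (I : finType) (A : {set I}) (X : I -> T -> U) : Prop :=
  forall (J : {set I}) (B : I -> set U), J \subset A ->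
    (forall i, measurable (B i)) ->
    P (\bigcap_(i in [set` J]) (X i @^-1` B i)) =
      (\prod_(i in J) P (X i @^-1` B i))%E.

(* Entry p a b stands for p_{ab}. *)
Definition probability_vector (R : realType) (p : bool -> bool -> R) : Prop :=
  (forall a b, 0 <= p a b) /\ \sum_a \sum_b p a b = 1.

Definition edge_indicators (T : Type) (n m : nat) (G1 G2 : T -> graph n m)
    (e : {set vertex n m}) : T -> bool * bool :=
  fun w => (e \in G1 w, e \in G2 w).

Record attributed_ER_pair d (T : measurableType d) (R : realType)
    (P : probability T R) (n : nat) (p : bool -> bool -> R)
    (m : nat) (q : bool -> bool -> R) (G1 G2 : T -> graph n m) : Prop := {
  er_graph1 : forall w, attributed_graph (G1 w) ;
  er_graph2 : forall w, attributed_graph (G2 w) ;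
  er_measurable : forall e, measurable_fun [set: T] (edge_indicators G1 G2 e) ;
  er_independent :
    mutually_independent P (user_pairs n m :|: user_attribute_pairs n m)%SET
      (edge_indicators G1 G2) ;
  er_user : forall e, e \in user_pairs n m -> forall a b,
    P (edge_indicators G1 G2 e @^-1` [set (a, b)]) = (p a b)%:E ;
  er_attribute : forall e, e \in user_attribute_pairs n m -> forall a b,
    P (edge_indicators G1 G2 e @^-1` [set (a, b)]) = (q a b)%:E
}.

Definition correlation d (T : measurableType d) (R : realType)
    (P : probability T R) (X Y : T -> R) : R :=
  fine (covariance P X Y) /
    (Num.sqrt (fine ('V_P[X])) * Num.sqrt (fine ('V_P[Y]))).

(* The coefficient is defined exactly when neither variance vanishes. *)
Definition positively_correlated d (T : measurableType d) (R : realType)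
    (P : probability T R) (X Y : T -> R) : Prop :=
  [/\ 'V_P[X] != 0%E, 'V_P[Y] != 0%E & 0 < correlation P X Y].

Definition positively_correlated_edges d (T : measurableType d) (R : realType)
    (P : probability T R) (n m : nat) (G1 G2 : T -> graph n m) : Prop :=
  forall e, e \in (user_pairs n m :|: user_attribute_pairs n m)%SET ->
    positively_correlated P (fun w => (e \in G1 w)%:R : R)
                            (fun w => (e \in G2 w)%:R : R).

Definition threshold (R : realType) (n m : nat) (p q : bool -> bool -> R) : R :=
  - n%:R * ln (1 - 2 * p true true + 2 * p true true ^+ 2)
  - m%:R * ln (1 - 2 * q true true + 2 * q true true ^+ 2)
  - 2 * ln n%:R.

(* Main.v *)
(* The first and second moment methods for the number N of ordered pairs of
   indistinguishable users. Let a = p11^2 + (1 - p11)^2, b = q11^2 + (1 - q11)^2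
   and x = n^2 a^n b^m, so that the threshold is - log x.
   Two given users are indistinguishable with probability a^(n-2) b^m, hence
   E N = n (n - 1) a^(n-2) b^m <= 4 x, which gives (ii).
   For (i), P(N > 0) >= (E N)^2 / E N^2. Two disjoint pairs contribute at most
   a^(2(n-4)) b^(2m), and pairs sharing one user at most c^(n-3) d^m, where
   c = p11^3 + (1 - p11)^3 satisfies c^2 <= a^3, and likewise d^2 <= b^3.
   Therefore E N^2 / (E N)^2 <= a^-4 + 8 sqrt (2 / x) + 4 / x. Moreover x >= 1
   gives - n log a <= 2 log n, so a tends to 1. *)

Require Import Defs.
From HB Require Import structures.
From mathcomp Require Import all_boot all_order all_algebra.
From mathcomp Require Import all_classical all_reals all_analysis.
From mathcomp Require Import ring lra zify.
Set Implicit Arguments.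
Unset Strict Implicit.
Unset Printing Implicit Defensive.
Import Order.TTheory GRing.Theory Num.Theory numFieldNormedType.Exports.
Local Open Scope ring_scope.

(** * The second moment inequality for a finite weighted set *)

Lemma second_moment (R : realFieldType) (G : finType) (mu : G -> R) (N : G -> R)
    (A : pred G) (b : R) :
  (forall g, 0 <= mu g) -> (forall g, ~~ A g -> N g = 0) ->
  0 < b -> \sum_g mu g * N g ^+ 2 <= b ->
  (\sum_g mu g * N g) ^+ 2 / b <= \sum_(g | A g) mu g.
Proof.
(* Expand [0 <= \sum_(g | A g) mu g * (t * N g - 1) ^+ 2] at the optimal [t]. *)
move=> mu0 NA b0 lb; set a := \sum_g mu g * N g; pose t := a / b.
have : 0 <= \sum_(g | A g) mu g * (t * N g - 1) ^+ 2.
  by apply: sumr_ge0 => g _; rewrite mulr_ge0 ?sqr_ge0.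
have -> : \sum_(g | A g) mu g * (t * N g - 1) ^+ 2
        = t ^+ 2 * (\sum_g mu g * N g ^+ 2) - 2 * t * a + \sum_(g | A g) mu g.
  have off k : \sum_g mu g * N g ^+ k.+1 = \sum_(g | A g) mu g * N g ^+ k.+1.
    rewrite [RHS]big_mkcond; apply: eq_bigr => g _; case: ifPn => // /NA ->.
    by rewrite expr0n mulr0.
  have -> : a = \sum_(g | A g) mu g * N g by rewrite -(off 0).
  rewrite (off 1) !mulr_sumr -sumrB -big_split /=.
  by apply: eq_bigr => g _; ring.
have : t ^+ 2 * (\sum_g mu g * N g ^+ 2) <= t ^+ 2 * b.
  by rewrite ler_wpM2l ?sqr_ge0.
have -> : t ^+ 2 * b = a ^+ 2 / b by rewrite /t; field; rewrite gt_eqF.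
have -> : 2 * t * a = 2 * (a ^+ 2 / b) by rewrite /t; ring.
by move: (\sum_(g | A g) mu g) (_ * \sum_g _) (_ / b) => *; lra.
Qed.

(** * Random subsets with independent coordinates *)

Section ProductLaw.
Variables (R : realFieldType) (F : finType) (mu : {set F} -> R).
Variables (E : {set F}) (r : F -> R).

(** Independence expressed through cylinders: [D] is the set of observed coordinates and [S]
    prescribes their values. The case of empty [D] says that [mu] has total mass 1. *)
Definition product_law :=
  forall D S : {set F}, D \subset E ->
  \sum_(g : {set F} | g :&: D == S :&: D) mu g
    = \prod_(e in D) (if e \in S then r e else 1 - r e).

Definition constant_on (g A : {set F}) : bool :=
  (A \subset g) || [disjoint A & g].

(* Expand the product on the right over the set of blocks contained in [g]. *)
Lemma sum_constant_on (C : finType) (A : C -> {set F}) :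
  product_law -> (forall c, A c != finset.set0) ->
  (forall c c', c != c' -> [disjoint A c & A c']) -> (forall c, A c \subset E) ->
  \sum_(g | [forall c, constant_on g (A c)]) mu g
    = \prod_c (\prod_(e in A c) r e + \prod_(e in A c) (1 - r e)).
Proof.
move=> law A0 Adis AE; rewrite bigA_distr.
pose D := (\bigcup_c A c)%SET; pose S (J : {set C}) := (\bigcup_(c in J) A c)%SET.
have memS J c e : e \in A c -> (e \in S J) = (c \in J).
  move=> eA; apply/bigcupP/idP => [[c' c'J eA']|cJ]; last by exists c.
  have [->//|/Adis/disjoint_setI0/setP/(_ e)] := eqVneq c c'.
  by rewrite !inE eA eA'.
rewrite (partition_big (fun g : {set F} => [set c | A c \subset g]%SET) predT) //=.
apply: eq_big => [J|J _]; first by rewrite !inE.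
(* The graphs that contain exactly the blocks of [J] and miss all the others are those with a
   prescribed trace on [D], so they form a cylinder to which [law] applies. *)
transitivity (\sum_(g : {set F} | g :&: D == S J :&: D) mu g).
  apply: eq_bigl => g; apply/andP/eqP => [[/forallP cst /eqP<-]|gS].
    apply/setP => e; rewrite !inE; case: (boolP (e \in D)); rewrite ?andbF ?andbT //.
    move=> /bigcupP[c _ eA]; rewrite (memS _ c) // inE.
    apply/idP/idP => [eg|/fintype.subsetP->//].
    have /orP[//|/disjoint_setI0/setP/(_ e)] := cst c.
    by rewrite !inE eA eg.
  have gE c e : e \in A c -> (e \in g) = (c \in J).
    move=> eA; have eD : e \in D by apply/bigcupP; exists c.
    by have /setP/(_ e) := gS; rewrite !inE eD !andbT (memS _ c).
  split.
    apply/forallP => c; rewrite /constant_on; have [cJ|cJ] := boolP (c \in J).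
      by apply/orP; left; apply/fintype.subsetP => e /gE ->.
    apply/orP; right; rewrite -setI_eq0; apply/eqP/setP => e; rewrite !inE.
    by apply/negP => /andP[/gE->]; apply/negP.
  apply/eqP/setP => c; rewrite inE; apply/fintype.subsetP/idP => [cg|cJ e /gE->//].
  (* An empty block would be contained in every [g]; nonemptiness is what lets [J] be recovered from
     the trace on [D]. *)
  by have /set0Pn[e eA] := A0 c; rewrite -(gE c e eA) cg.
rewrite law; last by apply/bigcupsP.
rewrite partition_disjoint_bigcup //; apply: eq_bigr => c _.
transitivity (\prod_(e in A c) (if c \in J then r e else 1 - r e)).
  by apply: eq_bigr => e /memS ->.
by case: ifP.
Qed.

Lemma constant_on2 (g : {set F}) a b :
  constant_on g [set a; b]%SET = ((a \in g) == (b \in g)).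
Proof.
rewrite /constant_on finset.disjoints_subset !finset.subUset !finset.sub1set !inE.
by case: (a \in g); case: (b \in g).
Qed.
End ProductLaw.

(** * First and second moments of a counting variable *)

Lemma sum_count (R : realFieldType) (G X : finType) (mu : G -> R)
    (Q : pred X) (S : X -> pred G) :
  \sum_g mu g * (\sum_(x | Q x) (S x g)%:R) = \sum_(x | Q x) \sum_(g | S x g) mu g.
Proof.
rewrite (eq_bigr (fun g => \sum_(x | Q x) mu g * (S x g)%:R)) => [|g _]; last first.
  by rewrite mulr_sumr.
rewrite exchange_big; apply: eq_bigr => x _; rewrite [RHS]big_mkcond.
by apply: eq_bigr => g _; case: (S x g); rewrite (mulr1, mulr0).
Qed.

(** The square of a count is the count of pairs of events that occur together, so linearity applies
    again. *)
Lemma sum_count_sqr (R : realFieldType) (G X : finType) (mu : G -> R)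
    (Q : pred X) (S : X -> pred G) :
  \sum_g mu g * (\sum_(x | Q x) (S x g)%:R) ^+ 2
    = \sum_(x | Q x) \sum_(y | Q y) \sum_(g | S x g && S y g) mu g.
Proof.
pose S2 (z : X * X) g := S z.1 g && S z.2 g.
rewrite pair_big /= -(sum_count mu (fun z => Q z.1 && Q z.2) S2).
apply: eq_bigr => g _; congr (_ * _); rewrite expr2 mulr_suml.
rewrite -(pair_big Q Q (fun x y => (S2 (x, y) g)%:R : R)) /=.
apply: eq_bigr => x _; rewrite mulr_sumr; apply: eq_bigr => y _.
by rewrite /S2 /= -mulnb natrM.
Qed.

(** * Edges between groups of users and the vertices outside them *)

Section Stars.
Variables (n m : nat).
Implicit Types (u : 'I_n) (v : vertex n m).

Definition possible_edges : {set {set vertex n m}} :=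
  (user_pairs n m :|: user_attribute_pairs n m)%SET.

(** These are the blocks of edges for [constant_on]: indistinguishability of the users in [A] makes
    the graph constant on each star whose centre [v] is outside [A]. *)
Definition star (A : {set 'I_n}) v : {set {set vertex n m}} :=
  [set [set user m u; v] | u in A]%SET.

(** An edge with exactly one endpoint in [U] determines which endpoint is which. Hence stars with
    distinct outside centres share no edge. *)
Lemma user_edge_inj (U : {set 'I_n}) u u' v v' :
  u \in U -> u' \in U ->
  v \notin (user m @: U)%SET -> v' \notin (user m @: U)%SET ->
  [set user m u; v]%SET = [set user m u'; v']%SET -> u = u' /\ v = v'.
Proof.
move=> uU u'U vU v'U /setP E; split.
  have := E (user m u); rewrite !inE eqxx /= => /esym/orP[/eqP[]//|/eqP uv].
  by rewrite -uv imset_f in v'U.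
have := E v; rewrite !inE eqxx orbT => /esym/orP[/eqP vu|/eqP//].
by rewrite vu imset_f in vU.
Qed.

Lemma star_sub (U A : {set 'I_n}) v : A \subset U ->
  v \notin (user m @: U)%SET -> star A v \subset possible_edges.
Proof.
move=> AU vU; apply/fintype.subsetP => e /imsetP[u uA ->]; rewrite inE.
have uU := fintype.subsetP AU u uA.
case: v vU => [j|a] vU; apply/orP; [left|right]; rewrite inE.
  apply/existsP; exists u; apply/existsP; exists j; rewrite eqxx andbT.
  by apply/eqP => uj; rewrite -uj imset_f in vU.
by apply/existsP; exists u; apply/existsP; exists a.
Qed.

Lemma user_attributeNuser u (a : 'I_m) :
  [set user m u; attribute n a]%SET \notin user_pairs n m.
Proof.
rewrite inE; apply/negP => /existsP[i /existsP[j /andP[_ /eqP/setP]]].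
by move/(_ (attribute n a)); rewrite !inE eqxx orbT.
Qed.

Variables (R : realFieldType) (mu : {set {set vertex n m}} -> R) (p q : R).

Definition edge_prob (e : {set vertex n m}) : R :=
  if e \in user_pairs n m then p else q.

(** The probability that [k] independent Bernoulli variables of parameter [x] all take the same
    value. *)
Definition agree k (x : R) : R := x ^+ k + (1 - x) ^+ k.

(** The stars from the groups [f c] to the vertices outside all groups are disjoint blocks of [k.+1]
    edges, hence independent. Each group sees the [n - k.+1 * #|C|] remaining users and all [m]
    attributes; the subtraction is exact because the groups are disjoint sets of users. *)
Lemma sum_constant_on_stars (C : finType) (f : C -> {set 'I_n}) k :
  product_law mu possible_edges edge_prob ->
  (forall c, #|f c| = k.+1) ->
  (forall c c', c != c' -> [disjoint f c & f c']) ->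
  \sum_(g | [forall c, forall v,
      (v \notin (user m @: \bigcup_c f c)%SET) ==> constant_on g (star (f c) v)])
     mu g
  = (agree k.+1 p ^+ (n - k.+1 * #|C|) * agree k.+1 q ^+ m) ^+ #|C|.
Proof.
move=> law fk fdis; set U := (\bigcup_c f c)%SET.
have fU c : f c \subset U by apply: finset.bigcup_sup.
have fUP c u : u \in f c -> u \in U by move/fintype.subsetP: (fU c); apply.
(* The blocks are indexed by a group and an outside vertex. Passing to the subtype over [K] builds
   the condition on the vertex into the index type that [sum_constant_on] expects. *)
pose K := [set x : C * vertex n m | x.2 \notin (user m @: U)%SET]%SET.
pose A (x : {x | x \in K}) := star (f (val x).1) (val x).2.
have xK (x : {x | x \in K}) : (val x).2 \notin (user m @: U)%SET.
  by have := valP x; rewrite inE.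
transitivity (\sum_(g | [forall x, constant_on g (A x)]) mu g).
  apply: eq_bigl => g; apply/forallP/forallP => [cst x|cst c].
    by have /forallP/(_ (val x).2)/implyP := cst (val x).1; apply.
  apply/forallP => v; apply/implyP => vU.
  have xP : (c, v) \in K by rewrite inE.
  exact: (cst (exist _ (c, v) xP)).
rewrite (sum_constant_on law); first last.
- by move=> x; apply: star_sub (xK x).
- move=> x x' neq; rewrite -setI_eq0; apply/eqP/setP => e; rewrite !inE.
  apply/negP => /andP[/imsetP[u uf ->] /imsetP[u' uf' E]].
  have [uu' vv'] := user_edge_inj (fUP _ _ uf) (fUP _ _ uf') (xK x) (xK x') E.
  case/negP: neq; apply/eqP/val_inj.
  have [cc'|/fdis/disjoint_setI0/setP/(_ u)] := eqVneq (val x).1 (val x').1.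
    by move: cc' vv'; case: (val x) => ? ?; case: (val x') => ? ? /= -> ->.
  by rewrite !inE uf uu' uf'.
- move=> x; apply/set0Pn.
  have /card_gt0P[u uf] : (0 < #|f (val x).1|)%N by rewrite fk.
  by exists [set user m u; (val x).2]%SET; apply: imset_f.
pose pv v := match v with inl _ => p | inr _ => q end.
pose h v := agree k.+1 (pv v).
have edge_probE c u v : u \in f c -> v \notin (user m @: U)%SET ->
    edge_prob [set user m u; v]%SET = pv v.
  rewrite /edge_prob; case: v => [j|a] uf vU /=; last first.
    by rewrite (negbTE (user_attributeNuser _ _)).
  rewrite inE (_ : [exists i, _]) //.
  apply/existsP; exists u; apply/existsP; exists j; rewrite eqxx andbT.
  by apply/eqP => uj; rewrite -uj imset_f ?(fUP c) in vU.
transitivity (\prod_(x : {x | x \in K}) h (val x).2).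
  apply: eq_bigr => x _.
  have inj : {in f (val x).1 &,
      injective (fun u => [set user m u; (val x).2]%SET)}.
    move=> u u' uf uf' E.
    by have [] := user_edge_inj (fUP _ _ uf) (fUP _ _ uf') (xK x) (xK x) E.
  have ep u : u \in f (val x).1 ->
      edge_prob [set user m u; (val x).2]%SET = pv (val x).2.
    by move=> uf; apply: edge_probE uf (xK x).
  rewrite /A /star !big_imset //=; congr (_ + _).
    by rewrite (eq_bigr (fun=> pv (val x).2)) // prodr_const fk.
  rewrite (eq_bigr (fun=> 1 - pv (val x).2)) => [|u uf]; last by rewrite ep.
  by rewrite prodr_const fk.
rewrite -(big_sub K (fun x : C * vertex n m => h x.2)).
rewrite (eq_bigl (fun x => true && (x.2 \notin (user m @: U)%SET))); last first.
  by move=> x; rewrite !inE.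
rewrite -(pair_big predT (fun v => v \notin (user m @: U)%SET) (fun c v => h v)) /=.
rewrite prodr_const big_sumType /=; congr ((_ * _) ^+ _).
- rewrite (eq_bigl (fun j => j \in ~: U)%SET) => [|j]; last first.
    rewrite !inE; congr (~~ _).
    by apply/imsetP/idP => [[i iU [->]]|jU] //; exists j.
  rewrite /h /= prodr_const; congr (_ ^+ _).
  have cardU : #|U| = (k.+1 * #|C|)%N.
    rewrite -sum1_card partition_disjoint_bigcup // mulnC -sum_nat_const.
    by apply: eq_bigr => c _; rewrite sum1_card fk.
  have : #|(~: U)%SET| = (n - #|U|)%N by rewrite cardsCs finset.setCK card_ord.
  by rewrite cardU.
- rewrite (eq_bigl predT) /h /= ?prodr_const ?card_ord // => a.
  by apply/imsetP => -[].
Qed.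

Definition indistb (g : graph n m) (i j : 'I_n) : bool :=
  [forall v, (v != user m i) && (v != user m j) ==>
    (([set user m i; v]%SET \in g) == ([set user m j; v]%SET \in g))].

Lemma indistP g i j : reflect (indistinguishable g i j) (indistb g i j).
Proof.
apply: (iffP forallP) => [H v vi vj|H v].
  by apply/eqP; apply: (implyP (H v)); rewrite vi vj.
by apply/implyP => /andP[vi vj]; apply/eqP/H.
Qed.

Lemma indistb_sym g i j : indistb g i j = indistb g j i.
Proof. by apply: eq_forallb => v; rewrite andbC [X in _ ==> X]eq_sym. Qed.

(** Every edge of the star is compared with the edge from the reference user [u0]. Since [v] lies
    outside [U], it differs from both users compared, as indistinguishability requires. *)
Lemma constant_on_star (g : graph n m) (U A : {set 'I_n}) u0 v :
  (forall u, u \in A -> indistb g u0 u) -> u0 \in U -> A \subset U ->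
  v \notin (user m @: U)%SET -> constant_on g (star A v).
Proof.
move=> tw u0U /fintype.subsetP AU vU.
have vN u : u \in U -> v != user m u.
  by move=> uU; apply: contraNneq vU => ->; apply: imset_f.
have gE u : u \in A -> ([set user m u; v]%SET \in g) = ([set user m u0; v]%SET \in g).
  move=> uA; have /indistP/(_ v) := tw u uA.
  by rewrite (vN _ u0U) (vN _ (AU _ uA)) => ->.
rewrite /constant_on; case: (boolP ([set user m u0; v]%SET \in g)) => gu0; apply/orP.
  by left; apply/fintype.subsetP => _ /imsetP[u /gE uE ->]; rewrite uE.
right; rewrite -setI_eq0; apply/eqP/setP => e; rewrite !inE.
by apply/negP => /andP[/imsetP[u /gE uE ->]]; rewrite uE; apply/negP.
Qed.

(** * Probabilities that one or two pairs are indistinguishable *)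

Hypothesis mu_ge0 : forall g, 0 <= mu g.
Hypothesis law : product_law mu possible_edges edge_prob.

Local Notation pr := (fun S : pred (graph n m) => \sum_(g | S g) mu g).

Lemma pr_mono (S S' : pred (graph n m)) : (forall g, S g -> S' g) -> pr S <= pr S'.
Proof.
move=> SS'; rewrite [leRHS](bigID S) /=.
have -> : pr S = \sum_(g | S' g && S g) mu g.
  by apply: eq_bigl => g; rewrite andbC; case: (boolP (S g)) => // /SS' ->.
by rewrite lerDl sumr_ge0.
Qed.

(** For a single group [{i, j}], constancy on the stars from outside vertices is equivalent to
    indistinguishability, so the value is exact. *)
Lemma pr_indist i j : i != j ->
  pr (fun g => indistb g i j) = agree 2 p ^+ (n - 2) * agree 2 q ^+ m.
Proof.
move=> ij; have := @sum_constant_on_stars unit (fun=> [set i; j]%SET) 1 law.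
rewrite card_unit muln1 expr1 => <-; last 2 first.
- by move=> _; rewrite cards2 ij.
- by case=> [] [].
have -> : (\bigcup_(c : unit) [set i; j])%SET = [set i; j]%SET :> {set 'I_n}.
  by apply/setP => x; apply/bigcupP/idP => [[]//|]; exists tt.
apply: eq_bigl => g; apply/idP/forallP => [gij _|/(_ tt)/forallP cst].
  apply/forallP => v; apply/implyP => vU.
  apply: (@constant_on_star g _ _ i v _ _ _ vU); rewrite ?inE ?eqxx //.
  move=> u; rewrite !inE => /orP[]/eqP-> //.
  by apply/indistP.
apply/indistP => v vi vj.
have vU : v \notin (user m @: [set i; j])%SET.
  by apply/imsetP => -[u]; rewrite !inE => /orP[]/eqP-> E; rewrite E eqxx in vi vj.
have /implyP/(_ vU) := cst v.
by rewrite /star imsetU1 imset_set1 constant_on2 => /eqP.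
Qed.

(* The constraints on the edges inside [{i, j, k}] are dropped. *)
Lemma pr_indist_sharing i j k : i != j -> i != k -> j != k ->
  pr (fun g => indistb g i j && indistb g i k)
    <= agree 3 p ^+ (n - 3) * agree 3 q ^+ m.
Proof.
move=> ij ik jk.
have := @sum_constant_on_stars unit (fun=> [set i; j; k]%SET) 2 law.
rewrite card_unit muln1 expr1 => <-; last 2 first.
- by move=> _; rewrite -finset.setUA cardsU1 cards2 !inE negb_or ij ik jk.
- by case=> [] [].
apply: pr_mono => g /andP[gij gik]; apply/forallP => c; apply/forallP => v.
apply/implyP => vU.
apply: (@constant_on_star g _ _ i v _ _ _ vU).
- by move=> u; rewrite !inE => /orP[/orP[]|]/eqP-> //; apply/indistP.
- by apply/bigcupP; exists c => //; rewrite !inE eqxx.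
- exact: (finset.bigcup_sup c).
Qed.

(* The constraints on the four edges between [{i, j}] and [{k, l}], the only
   ones that couple the two events, are dropped; this costs a factor
   [agree 2 p ^- 4], which tends to 1. *)
Lemma pr_indist_disjoint i j k l : i != j -> k != l ->
  i != k -> i != l -> j != k -> j != l ->
  pr (fun g => indistb g i j && indistb g k l)
    <= (agree 2 p ^+ (n - 4) * agree 2 q ^+ m) ^+ 2.
Proof.
move=> ij kl ik il jk jl.
pose f b := if b then [set i; j]%SET else [set k; l]%SET.
have := @sum_constant_on_stars bool f 1 law.
rewrite card_bool => <-; last 2 first.
- by case; rewrite cards2 ?ij ?kl.
- have d : [disjoint [set i; j]%SET & [set k; l]%SET].
    rewrite finset.disjoints_subset finset.subUset !finset.sub1set !inE !negb_or.
    by rewrite ik il jk jl.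
  by case=> [] [] //; rewrite disjoint_sym.
apply: pr_mono => g /andP[gij gkl]; apply/forallP => c; apply/forallP => v.
apply/implyP => vU.
apply: (@constant_on_star g _ _ (if c then i else k) v _ _ _ vU).
- by case: c => u; rewrite !inE => /orP[]/eqP-> //; apply/indistP.
- by apply/bigcupP; exists c => //; case: c; rewrite !inE eqxx.
- exact: (finset.bigcup_sup c).
Qed.

(** * Moments of the number of ordered indistinguishable pairs *)

Definition has_indistb (g : graph n m) : bool :=
  [exists x : 'I_n * 'I_n, (x.1 != x.2) && indistb g x.1 x.2].

Lemma has_indistP g : reflect (has_indistinguishable_users g) (has_indistb g).
Proof.
apply: (iffP existsP) => [[[i j] /= /andP[ij /indistP]]|[i [j [ij /indistP gij]]]].
  by exists i, j.
by exists (i, j); rewrite ij.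
Qed.

Lemma card_offdiag : #|[pred x : 'I_n * 'I_n | x.1 != x.2]| = (n * n.-1)%N.
Proof.
pose diag : {set 'I_n * 'I_n} := [set x | x.1 == x.2]%SET.
have cardD : #|diag| = n.
  rewrite (_ : diag = (fun a => (a, a)) @: finset.setT)%SET.
    by rewrite card_imset ?cardsT ?card_ord // => a b [].
  apply/setP => -[a b]; rewrite !inE /=.
  by apply/eqP/imsetP => [->|[c _ [-> ->]]//]; exists b.
transitivity #|(~: diag)%SET|; first by apply: eq_card => x; rewrite !inE.
by rewrite cardsCs finset.setCK cardD card_prod card_ord -subn1 mulnBr muln1.
Qed.

(** [pairs] counts ordered pairs of distinct users. [P2] is the probability for one pair; [P3] and
    [P22] bound it for two pairs sharing one user and for two disjoint pairs. *)
Let pairs : R := (n * n.-1)%:R.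
Let P2 : R := agree 2 p ^+ (n - 2) * agree 2 q ^+ m.
Let P3 : R := agree 3 p ^+ (n - 3) * agree 3 q ^+ m.
Let P22 : R := (agree 2 p ^+ (n - 4) * agree 2 q ^+ m) ^+ 2.

Lemma sum_pr_indist :
  \sum_(x : 'I_n * 'I_n | x.1 != x.2) pr (fun g => indistb g x.1 x.2) = pairs * P2.
Proof.
rewrite (eq_bigr (fun=> P2)) => [|x xx]; last exact: pr_indist.
by rewrite sumr_const card_offdiag mulr_natl.
Qed.

(** Markov's inequality: the indicator of the event is at most the number of indistinguishable
    pairs. *)
Lemma pr_has_indist_le : pr has_indistb <= pairs * P2.
Proof.
rewrite -sum_pr_indist -(sum_count mu _ (fun x g => indistb g x.1 x.2)).
rewrite big_mkcond ler_sum // => g _; case: ifPn => [/existsP[x /andP[xx gx]]|_].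
  rewrite ler_peMr // (bigD1 x) //= gx lerDl.
  by apply: sumr_ge0 => *; apply: ler0n.
by rewrite mulr_ge0 // sumr_ge0 // => *; apply: ler0n.
Qed.

Hypotheses (p01 : 0 <= p <= 1) (q01 : 0 <= q <= 1).

Lemma agree_ge0 k x : 0 <= x <= 1 -> 0 <= agree k x.
Proof. by move=> /andP[x0 x1]; rewrite addr_ge0 ?exprn_ge0 ?subr_ge0. Qed.

Lemma agree2_gt0 x : 0 < agree 2 x.
Proof. by rewrite /agree; nra. Qed.

(** The indicators record how [y] meets [x]: the first four detect a shared user, the last two
    detect that [y] is [x] or its swap. Overlapping indicators only enlarge the bound, and this form
    can be summed over [y] without cases. *)
Lemma pr_two_indist (x y : 'I_n * 'I_n) : x.1 != x.2 -> y.1 != y.2 ->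
  pr (fun g => indistb g x.1 x.2 && indistb g y.1 y.2)
    <= P22 + P3 * ((y.1 == x.1)%:R + (y.1 == x.2)%:R
                   + (y.2 == x.1)%:R + (y.2 == x.2)%:R)
       + P2 * ((y == x)%:R + (y == (x.2, x.1))%:R).
Proof.
have P2_ge0 : 0 <= P2 by rewrite mulr_ge0 // exprn_ge0 // ltW // agree2_gt0.
have P3_ge0 : 0 <= P3 by rewrite mulr_ge0 // exprn_ge0 // agree_ge0.
have P22_ge0 : 0 <= P22 by rewrite sqr_ge0.
(* All terms on the right are nonnegative, so it suffices to bound [z] by one term whose indicator
   is on. *)
have bound (s1 s2 s3 s4 t1 t2 : bool) z :
    (z <= P2 /\ t1 || t2) \/ (z <= P3 /\ [|| s1, s2, s3 | s4])
    \/ z <= P22 ->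
    z <= P22 + P3 * (s1%:R + s2%:R + s3%:R + s4%:R) + P2 * (t1%:R + t2%:R).
  move=> H.
  have h3 : 0 <= P3 * (s1%:R + s2%:R + s3%:R + s4%:R).
    by rewrite mulr_ge0 // !addr_ge0 // ler0n.
  have h2 : 0 <= P2 * (t1%:R + t2%:R) by rewrite mulr_ge0 // addr_ge0 // ler0n.
  case: H => [[zP t]|[[zP s]|zP]]; last by lra.
  - suff : P2 <= P2 * (t1%:R + t2%:R) by lra.
    by rewrite ler_peMr // -natrD ler1n; case: t1 t2 t {h2} => [] [].
  - suff : P3 <= P3 * (s1%:R + s2%:R + s3%:R + s4%:R) by lra.
    rewrite ler_peMr // -!natrD ler1n.
    by case: s1 s2 s3 s4 s {h3} => [] [] [] [].
case: x y => [i j] [k l] /= ij kl; apply: bound; rewrite !xpair_eqE.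
have [ki|ki] := eqVneq k i; [subst k|have [kj|kj] := eqVneq k j; [subst k|]].
- have [lj|lj] := eqVneq l j.
    by left; split=> //; rewrite /P2 -(pr_indist ij); apply: pr_mono => g /andP[].
  by right; left; split=> //; apply: pr_indist_sharing; rewrite // eq_sym.
- have [li|li] := eqVneq l i.
    left; split; last by rewrite orbT.
    by rewrite /P2 -(pr_indist ij); apply: pr_mono => g /andP[].
  (* Symmetry moves the shared user to the first place of both pairs, where [pr_indist_sharing]
     expects it; the same device serves below. *)
  right; left; split=> //; under eq_bigl do rewrite indistb_sym.
  by apply: pr_indist_sharing; rewrite // eq_sym.
- have [li|li] := eqVneq l i; [subst l|have [lj|lj] := eqVneq l j; [subst l|]].
  + right; left; split=> //; under eq_bigl do rewrite (indistb_sym _ k).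
    by apply: pr_indist_sharing; rewrite // eq_sym.
  + right; left; split=> //.
    under eq_bigl do rewrite indistb_sym (indistb_sym _ k).
    by apply: pr_indist_sharing; rewrite // eq_sym.
  + by right; right; apply: pr_indist_disjoint; rewrite // eq_sym.
Qed.

(** The two equations are paired by a product, not a conjunction, so that they act as one rewrite
    rule. *)
Lemma sum_coord_eq (i : 'I_n) :
  (\sum_(y : 'I_n * 'I_n) (y.1 == i)%:R = n%:R :> R) *
  (\sum_(y : 'I_n * 'I_n) (y.2 == i)%:R = n%:R :> R).
Proof.
have one : \sum_(a : 'I_n) (a == i)%:R = 1 :> R.
  by rewrite (bigD1 i) //= eqxx big1 ?addr0 // => a /negbTE ->.
split.
  rewrite -(pair_big predT predT (fun a b : 'I_n => (a == i)%:R : R)) /=.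
  by rewrite exchange_big /= (eq_bigr (fun=> 1)) ?sumr_const ?card_ord.
rewrite -(pair_big predT predT (fun a b : 'I_n => (b == i)%:R : R)) /=.
by rewrite (eq_bigr (fun=> 1)) ?sumr_const ?card_ord.
Qed.

Lemma pr_has_indist_ge : (1 < n)%N ->
  pairs * P2 ^+ 2 / (pairs * P22 + 4 * n%:R * P3 + 2 * P2) <= pr has_indistb.
Proof.
move=> n1; have P2_gt0 : 0 < P2 by rewrite mulr_gt0 // exprn_gt0 // agree2_gt0.
have P3_ge0 : 0 <= P3 by rewrite mulr_ge0 // exprn_ge0 // agree_ge0.
have P22_ge0 : 0 <= P22 by rewrite sqr_ge0.
have c_gt0 : 0 < pairs by rewrite ltr0n muln_gt0; lia.
set b := _ + 2 * P2.
have b_gt0 : 0 < b.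
  rewrite /b ltr_wpDl ?(mulr_gt0 _ P2_gt0) //.
  by rewrite addr_ge0 // mulr_ge0 ?(ltW c_gt0) // -natrM ler0n.
pose N g : R := \sum_(x : 'I_n * 'I_n | x.1 != x.2) (indistb g x.1 x.2)%:R.
(* For each [x] the sum over [y] is at most [b], so the second moment is at most [pairs * b]; one
   factor [pairs] cancels against the squared mean. *)
have -> : pairs * P2 ^+ 2 / b = (\sum_g mu g * N g) ^+ 2 / (pairs * b).
  rewrite (sum_count mu _ (fun x g => indistb g x.1 x.2)) sum_pr_indist.
  have cancel (x y z : R) : x != 0 -> z != 0 -> x * y ^+ 2 / z = (x * y) ^+ 2 / (x * z).
    by move=> x0 z0; field; rewrite ?x0 ?z0.
  by apply: cancel; rewrite gt_eqF.
apply: second_moment => //; last 2 first.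
- by rewrite mulr_gt0.
- rewrite (sum_count_sqr mu _ (fun x g => indistb g x.1 x.2)).
  rewrite /pairs -card_offdiag mulr_natl -sumr_const ler_sum // => x xx.
  apply: (@le_trans _ _ (\sum_(y : 'I_n * 'I_n | y.1 != y.2)
     (P22 + (P3 * ((y.1 == x.1)%:R + (y.1 == x.2)%:R
                   + (y.2 == x.1)%:R + (y.2 == x.2)%:R)
             + P2 * ((y == x)%:R + (y == (x.2, x.1))%:R))))).
    by apply: ler_sum => y yy; rewrite addrA; apply: pr_two_indist.
  rewrite big_split /= sumr_const card_offdiag -[P22 *+ _]mulr_natl /b -addrA lerD2l.
  (* The main term [P22] has been summed over exactly [pairs] values of [y]. Only the remaining
     nonnegative terms are extended to the diagonal, where each indicator has a simple total. *)
  apply: (@le_trans _ _ (\sum_(y : 'I_n * 'I_n)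
       (P3 * ((y.1 == x.1)%:R + (y.1 == x.2)%:R
                   + (y.2 == x.1)%:R + (y.2 == x.2)%:R)
             + P2 * ((y == x)%:R + (y == (x.2, x.1))%:R)))).
    rewrite big_mkcond ler_sum // => y _; case: ifP => // _.
    by rewrite addr_ge0 // mulr_ge0 ?(ltW P2_gt0) // ?addr_ge0 // ler0n.
  have one z : \sum_(y : 'I_n * 'I_n) (y == z)%:R = 1 :> R.
    by rewrite (bigD1 z) //= eqxx big1 ?addr0 // => y /negbTE ->.
  rewrite big_split /= -!mulr_sumr !big_split /= !sum_coord_eq !one.
  by rewrite le_eqVlt; apply/orP; left; apply/eqP; ring.
move=> g gN; rewrite /N big1 // => x xx; case: (boolP (indistb _ _ _)) => // gx.
by case/existsP: gN; exists x; rewrite xx.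
Qed.
End Stars.

Local Open Scope classical_set_scope.

(** * The law of the intersection graph *)

Section Law.
Context d (T : measurableType d) (R : realType) (P : probability T R).

Section FiniteVariable.
Variables (G : finType) (X : T -> G).
Hypothesis mX : forall g, measurable [set w | X w = g].

Definition law (g : G) : R := fine (P [set w | X w = g]).

Lemma law_ge0 g : 0 <= law g.
Proof. exact: fine_ge0. Qed.

Lemma measurable_law (S : pred G) : measurable [set w | S (X w)].
Proof.
have -> : [set w | S (X w)] = \bigcup_(g in [set` S]) [set w | X w = g].
  apply/seteqP; split => [w Sw|w [g Sg /= ->]//]; by exists (X w).
exact: fin_bigcup_measurable.
Qed.

Lemma prob_law (S : pred G) : P [set w | S (X w)] = (\sum_(g | S g) law g)%:E.
Proof.
have -> : [set w | S (X w)] = \bigcup_(g in [set` S]) [set w | X w = g].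
  apply/seteqP; split => [w Sw|w [g Sg /= ->]//]; by exists (X w).
rewrite measure_fin_bigcup //; last first.
  by move=> g g' _ _ [w [/= -> ->]].
rewrite -(@bigfs _ _ _ _ (index_enum G)) ?index_enum_uniq //; last first.
  by move=> g _; rewrite mem_index_enum.
rewrite -sumEFin; apply: eq_bigr => g _; rewrite /law fineK //.
exact: fin_num_measure.
Qed.
End FiniteVariable.

Context (n m : nat) (p q : bool -> bool -> R) (G1 G2 : T -> graph n m).
Hypothesis hG : attributed_ER_pair P p q G1 G2.

Let G w := intersection_graph (G1 w) (G2 w).

Lemma measurable_bool2 (B : set (bool * bool)) : measurable B.
Proof.
have -> : B = \bigcup_(x in B) [set x].
  by apply/seteqP; split => [x Bx|x [y By /= ->]//]; exists x.
apply: fin_bigcup_measurable => [|[a b] _]; first exact: finite_finset.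
have -> : [set (a, b)] = [set a] `*` [set b].
  by apply/seteqP; split => [_ -> //|[a' b'] [/= -> ->]].
exact: measurableX.
Qed.

Lemma in_intersection (b : bool) e : [set w | (e \in G w) = b] =
  edge_indicators G1 G2 e @^-1` [set x | x.1 && x.2 = b].
Proof. by apply/seteqP; split => w; rewrite /= /G inE. Qed.

Lemma measurable_intersection g : measurable [set w | G w = g].
Proof.
have -> : [set w | G w = g] =
    \bigcap_(e in [set: {set vertex n m}]) [set w | (e \in G w) = (e \in g)].
  apply/seteqP; split => [w <- e _ //|w Gw].
  by apply/setP => e; apply: Gw.
apply: fin_bigcap_measurable => [|e _]; first exact: finite_finset.
rewrite in_intersection -[_ @^-1` _]setTI.
by apply: (er_measurable hG) => //; apply: measurable_bool2.
Qed.

(** A cylinder for the intersection graph is an intersection of events each depending on one edge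
    indicator, so independence turns its probability into a product. *)
Lemma product_law_intersection :
  product_law (law G) (possible_edges n m) (edge_prob (p true true) (q true true)).
Proof.
move=> D S DE; apply: EFin_inj.
rewrite -(prob_law measurable_intersection (fun g => g :&: D == S :&: D)%SET).
pose B (e : {set vertex n m}) := [set x : bool * bool | x.1 && x.2 = (e \in S)].
have -> : [set w | (G w :&: D == S :&: D)%SET] =
    \bigcap_(e in [set` D]) (edge_indicators G1 G2 e @^-1` B e).
  apply/seteqP; split => [w /= /eqP/setP GS e eD|w GS].
    by have := GS e; rewrite !inE eD !andbT.
  apply/eqP/setP => e; rewrite !inE.
  by have [eD|] := boolP (e \in D); rewrite ?andbF // !andbT; apply: (GS e).
rewrite (er_independent hG) //; last by move=> e; apply: measurable_bool2.
rewrite -prodEFin; apply: eq_bigr => e eD.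
have Pe : P (edge_indicators G1 G2 e @^-1` [set (true, true)])
    = (edge_prob (p true true) (q true true) e)%:E.
  rewrite /edge_prob; case: ifP => eu; first exact: (er_user hG).
  apply: (er_attribute hG); move/fintype.subsetP: DE => /(_ e eD).
  by rewrite inE eu.
have B1 : [set x : bool * bool | x.1 && x.2 = true] = [set (true, true)].
  by apply/seteqP; split => [[[] []]|_ ->].
rewrite /B; case: (e \in S); first by rewrite B1.
(* An edge is absent from the intersection unless it is in both graphs, which gives the factor
   [1 - r e] as a complement. *)
have -> : [set x : bool * bool | x.1 && x.2 = false] = ~` [set (true, true)].
  by rewrite -B1; apply/seteqP; split => [[[] []]|[[] []]] //= [].
rewrite -preimage_setC probability_setC ?Pe //.
rewrite -[_ @^-1` _]setTI.
by apply: (er_measurable hG) => //; apply: measurable_bool2.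
Qed.

End Law.

(** * Comparison of the squared mean with the second moment bound *)

Section Ratio.
Variable (R : realType).
Implicit Types (p q : R) (n m : nat).

Lemma agree2_le1 p : 0 <= p <= 1 -> agree 2 p <= 1.
Proof. by rewrite /agree => /andP[]; nra. Qed.

Lemma agree2_ge p : 2^-1 <= agree 2 p.
Proof. by rewrite /agree; have := sqr_ge0 (p - 2^-1); lra. Qed.

(* With [s = p (1 - p)], [agree 2 p = 1 - 2 s] and [agree 3 p = 1 - 3 s]. *)
Lemma agree3_sqr_le p : 0 <= p <= 1 -> agree 3 p ^+ 2 <= agree 2 p ^+ 3.
Proof.
move=> /andP[p0 p1]; pose s := p * (1 - p).
have -> : agree 2 p = 1 - 2 * s by rewrite /agree /s; ring.
have -> : agree 3 p = 1 - 3 * s by rewrite /agree /s; ring.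
have s0 : 0 <= s by rewrite mulr_ge0 // subr_ge0.
have s1 : s <= 4^-1 by have := sqr_ge0 (p - 2^-1); rewrite /s; lra.
(* This is the difference [(1 - 2 * s) ^+ 3 - (1 - 3 * s) ^+ 2]. *)
have : 0 <= s ^+ 2 * (3 - 8 * s) by rewrite mulr_ge0 ?sqr_ge0 //; lra.
by lra.
Qed.

(** Here [c] is the number of ordered pairs, [N] is [n], [a] is [agree 2 p], [z] is
    [a ^+ (n - 4) * agree 2 q ^+ m] and [Y] is the bound for pairs sharing a user. The inverse of
    the right-hand side splits into three terms, bounded one by one. *)
Lemma moment_ratio_aux (c N a z Y : R) (x := N ^+ 2 * (a ^+ 4 * z)) :
  0 < N -> N ^+ 2 <= 2 * c -> 2^-1 <= a -> a <= 1 -> 0 < z ->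
  0 <= Y -> Y ^+ 2 <= (a * z) ^+ 3 ->
  (a ^- 4 + 8 * Num.sqrt (2 / x) + 4 / x)^-1 <=
  c * (a ^+ 2 * z) ^+ 2 / (c * z ^+ 2 + 4 * N * Y + 2 * (a ^+ 2 * z)).
Proof.
move=> N0 N2 a2 a1 z0 Y0 Y2.
have a0 : 0 < a by lra.
have NN0 : 0 < N ^+ 2 by rewrite exprn_gt0.
have c0 : 0 < c by lra.
have x0 : 0 < x by rewrite !mulr_gt0 ?exprn_gt0.
have YN0 : 0 <= Y / (N * a ^+ 4 * z ^+ 2).
  by rewrite divr_ge0 // !mulr_ge0 ?exprn_ge0 // ltW.
(* After squaring, the claim reduces to [a ^+ 3 <= 2 * a ^+ 4], true since [a] is at least 1/2; this
   is the 2 under the root. *)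
have sqrtP : Y / (N * a ^+ 4 * z ^+ 2) <= Num.sqrt (2 / x).
  rewrite -[leLHS]ger0_norm // -sqrtr_sqr ler_wsqrtr //.
  have -> : 2 / x = 2 * a ^+ 4 * z ^+ 3 / (N * a ^+ 4 * z ^+ 2) ^+ 2.
    by rewrite /x; field; rewrite !gt_eqF.
  rewrite exprMn exprVn ler_pM2r ?invr_gt0 ?exprn_gt0 ?mulr_gt0 ?exprn_gt0 //.
  apply: le_trans Y2 _; rewrite -subr_ge0.
  have -> : 2 * a ^+ 4 * z ^+ 3 - (a * z) ^+ 3 = (2 * a - 1) * (a * z) ^+ 3 by ring.
  by rewrite mulr_ge0 ?exprn_ge0 ?mulr_ge0 ?(ltW a0) ?(ltW z0) //; lra.
(* The constant 8 is 4 times the bound 2 on [N ^+ 2 / c]. *)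
have YcP : 4 * N * Y / (c * a ^+ 4 * z ^+ 2) <= 8 * Num.sqrt (2 / x).
  have -> : 4 * N * Y / (c * a ^+ 4 * z ^+ 2)
      = 4 * (N ^+ 2 / c) * (Y / (N * a ^+ 4 * z ^+ 2)).
    by field; rewrite !gt_eqF.
  have Nc : N ^+ 2 / c <= 2 by rewrite ler_pdivrMr.
  apply: ler_pM => //; last by lra.
  by rewrite mulr_ge0 ?divr_ge0 ?ltW.
have zP : 2 / (c * a ^+ 2 * z) <= 4 / x.
  rewrite ler_pdivrMr ?mulr_gt0 ?exprn_gt0 // mulrAC ler_pdivlMr // /x.
  rewrite -subr_ge0.
  have -> : 4 * (c * a ^+ 2 * z) - 2 * (N ^+ 2 * (a ^+ 4 * z))
     = 2 * (a ^+ 2 * z) * ((2 * c - N ^+ 2) + N ^+ 2 * (1 - a ^+ 2)) by ring.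
  have a21 : a ^+ 2 <= 1 by rewrite expr_le1 // ltW.
  rewrite mulr_ge0 ?mulr_ge0 ?exprn_ge0 ?(ltW a0) ?(ltW z0) // addr_ge0 //.
    by lra.
  by rewrite mulr_ge0 ?(ltW NN0) ?subr_ge0.
have Den0 : 0 < c * z ^+ 2 + 4 * N * Y + 2 * (a ^+ 2 * z).
  rewrite ltr_wpDl ?mulr_gt0 ?exprn_gt0 //.
  by rewrite addr_ge0 // !mulr_ge0 ?exprn_ge0 // ltW.
rewrite -[leRHS]invrK lef_pV2 ?posrE; last 2 first.
- by rewrite addr_gt0 ?divr_gt0 // ltr_wpDr ?invr_gt0 ?exprn_gt0.
- by rewrite invr_gt0 divr_gt0 // mulr_gt0 ?exprn_gt0 ?mulr_gt0 ?exprn_gt0.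
have -> : (c * (a ^+ 2 * z) ^+ 2 / (c * z ^+ 2 + 4 * N * Y + 2 * (a ^+ 2 * z)))^-1
   = a ^- 4 + 4 * N * Y / (c * a ^+ 4 * z ^+ 2) + 2 / (c * a ^+ 2 * z).
  by field; rewrite !gt_eqF.
by rewrite !lerD.
Qed.

(** The condition [3 < n] makes the truncated exponents genuine, so that powers of [agree 2 p] can
    be factored out. *)
Lemma moment_ratio_ge n m p q (x := n%:R ^+ 2 * agree 2 p ^+ n * agree 2 q ^+ m) :
  (3 < n)%N -> 0 <= p <= 1 -> 0 <= q <= 1 ->
  (agree 2 p ^- 4 + 8 * Num.sqrt (2 / x) + 4 / x)^-1 <=
  (n * n.-1)%:R * (agree 2 p ^+ (n - 2) * agree 2 q ^+ m) ^+ 2 /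
    ((n * n.-1)%:R * (agree 2 p ^+ (n - 4) * agree 2 q ^+ m) ^+ 2
     + 4 * n%:R * (agree 3 p ^+ (n - 3) * agree 3 q ^+ m)
     + 2 * (agree 2 p ^+ (n - 2) * agree 2 q ^+ m)).
Proof.
move=> n4 p01 q01; rewrite /x {x}.
have P3_ge0 : 0 <= agree 3 p ^+ (n - 3) * agree 3 q ^+ m.
  by rewrite mulr_ge0 // exprn_ge0 // agree_ge0.
have P3_sqr : (agree 3 p ^+ (n - 3) * agree 3 q ^+ m) ^+ 2
    <= (agree 2 p ^+ (n - 3) * agree 2 q ^+ m) ^+ 3.
  have pow k (x : R) : 0 <= x <= 1 -> (agree 3 x ^+ k) ^+ 2 <= (agree 2 x ^+ k) ^+ 3.
    move=> x01; rewrite -!exprM ![(k * _)%N]mulnC !exprM.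
    by rewrite lerXn2r ?nnegrE ?exprn_ge0 ?agree3_sqr_le ?agree_ge0.
  by rewrite !exprMn ler_pM ?sqr_ge0 ?pow.
have [k En] : exists k, n = k.+4 by exists (n - 4)%N; lia.
have -> : n%:R ^+ 2 * agree 2 p ^+ n * agree 2 q ^+ m
    = n%:R ^+ 2 * (agree 2 p ^+ 4 * (agree 2 p ^+ (n - 4) * agree 2 q ^+ m)).
  by rewrite En !subSS subn0 -addn4 exprD; ring.
have e1 : agree 2 p ^+ (n - 2) = agree 2 p ^+ 2 * agree 2 p ^+ (n - 4).
  by rewrite -exprD; congr (_ ^+ _); lia.
rewrite e1 -[agree 2 p ^+ 2 * _ * _]mulrA; apply: moment_ratio_aux => //.
- by rewrite ltr0n; lia.
- by rewrite -natrX -natrM ler_nat; lia.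
- exact: agree2_ge.
- exact: agree2_le1.
- by rewrite mulr_gt0 // exprn_gt0 // agree2_gt0.
rewrite mulrA -exprS.
by have <- : (n - 3)%N = (n - 4).+1 by lia.
Qed.
End Ratio.

(** * The threshold and the convergence of [agree 2] to 1 *)

Section Asymptotics.
Variable R : realType.

Lemma agree2E (p : R) : 1 - 2 * p + 2 * p ^+ 2 = agree 2 p.
Proof. by rewrite /agree; ring. Qed.

Lemma expR_threshold n m (p q : bool -> bool -> R) : (0 < n)%N ->
  expR (- threshold n m p q)
    = n%:R ^+ 2 * agree 2 (p true true) ^+ n * agree 2 (q true true) ^+ m.
Proof.
move=> n0; rewrite /threshold !agree2E.
set a := agree 2 (p _ _); set b := agree 2 (q _ _).
have -> : - (- n%:R * ln a - m%:R * ln b - 2 * ln n%:R)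
    = 2%:R * ln n%:R + n%:R * ln a + m%:R * ln b by ring.
by rewrite !expRD !expRM_natl !lnK ?posrE ?agree2_gt0 // ltr0n.
Qed.

(** The attribute term of the threshold is nonnegative, so [- n * ln a <= 2 * ln n]. Combine this
    with [ln a <= a - 1] and [ln n <= 2 * sqrt n]. *)
Lemma agree2_ge_threshold n m (p q : bool -> bool -> R) : (0 < n)%N ->
  0 <= q true true <= 1 -> threshold n m p q <= 0 ->
  1 - 4 * Num.sqrt n%:R^-1 <= agree 2 (p true true).
Proof.
move=> n0 q01; rewrite /threshold !agree2E.
set a := agree 2 (p _ _); set b := agree 2 (q _ _) => t0.
have N0 : 0 < n%:R :> R by rewrite ltr0n.
have lb : m%:R * ln b <= 0 by rewrite mulr_ge0_le0 // ln_le0 // agree2_le1.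
have la : ln a <= a - 1.
  have := @le_ln1Dx R (a - 1); rewrite addrCA subrr addr0; apply.
  by have := agree2_gt0 (p true true); rewrite -/a; lra.
(* Write [ln n] as twice the logarithm of [sqrt n] and use [ln s < s]. *)
have ln_sqrt : ln n%:R <= 2 * Num.sqrt n%:R :> R.
  have s0 : 0 < Num.sqrt n%:R :> R by rewrite sqrtr_gt0.
  rewrite -[in leLHS](sqr_sqrtr (ltW N0)) lnXn // -[ln _ *+ 2]mulr_natl.
  by rewrite ler_wpM2l // ltW // ln_sublinear.
have : n%:R * (1 - a) <= n%:R * (4 * Num.sqrt n%:R^-1).
  have -> : n%:R * (4 * Num.sqrt n%:R^-1) = 4 * Num.sqrt n%:R :> R.
    rewrite sqrtrV // -[X in X * _](sqr_sqrtr (ltW N0)).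
    by field; rewrite gt_eqF // sqrtr_gt0.
  apply: (@le_trans _ _ (- (n%:R * ln a))); last by lra.
  by rewrite -mulrN ler_wpM2l //; lra.
by rewrite ler_pM2l //; lra.
Qed.

Lemma cvg_agree2 (m : nat -> nat) (p q : nat -> bool -> bool -> R) :
  (forall n, 0 <= p n true true <= 1) -> (forall n, 0 <= q n true true <= 1) ->
  (fun n => threshold n (m n) (p n) (q n)) @ \oo --> -oo ->
  (fun n => agree 2 (p n true true)) @ \oo --> (1 : R).
Proof.
move=> p01 q01 t; apply: (@squeeze_cvgr _ _ _ _ (fun n => 1 - 4 * Num.sqrt n%:R^-1) (cst 1)).
- near=> n; rewrite agree2_le1 // andbT.
  apply: (@agree2_ge_threshold _ (m n) (p n) (q n)) => //.
    by near: n; exact: nbhs_infty_gt.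
  by near: n; exact: cvgrNy_le.
- rewrite -[X in _ --> X]subr0 -[X in _ --> _ - X](mulr0 4).
  apply: cvgB; first exact: cvg_cst.
  apply: cvgMr; rewrite -[X in _ --> X]sqrtr0.
  apply: (@cvg_comp _ _ _ (fun n => n%:R^-1) Num.sqrt); last exact: sqrt_continuous.
  apply/gtr0_cvgV0; last exact: cvgr_idn.
  by near=> n; rewrite ltr0n; near: n; exact: nbhs_infty_gt.
- exact: cvg_cst.
Unshelve. all: by end_near. Qed.

End Asymptotics.

Lemma probability_vector_bounds (R : realType) (p : bool -> bool -> R) a b :
  probability_vector p -> 0 <= p a b <= 1.
Proof.
move=> [p0 <-]; rewrite p0 /= (bigD1 a) //= (bigD1 b) //= -addrA lerDl.
by rewrite addr_ge0 // sumr_ge0 // => *; rewrite sumr_ge0.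
Qed.

(** * Bounds in terms of the threshold at fixed [n] *)

Section OnePair.
Context d (T : measurableType d) (R : realType) (P : probability T R).
Context (n m : nat) (p q : bool -> bool -> R) (G1 G2 : T -> graph n m).
Hypotheses (hp : probability_vector p) (hq : probability_vector q).
Hypothesis hG : attributed_ER_pair P p q G1 G2.

Let G w := intersection_graph (G1 w) (G2 w).

Definition indist_prob : R := \sum_(g | has_indistb g) law P G g.

Let indist_event :
  [set w | has_indistinguishable_users (G w)] = [set w | has_indistb (G w)].
Proof. by apply/seteqP; split => w /has_indistP. Qed.

Lemma indist_probE :
  P [set w | has_indistinguishable_users (G w)] = indist_prob%:E.
Proof. by rewrite indist_event (prob_law P (measurable_intersection hG)). Qed.

Lemma indist_probNE :
  P [set w | ~ has_indistinguishable_users (G w)] = (1 - indist_prob)%:E.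
Proof.
rewrite -[[set w | _]]/(~` [set w | has_indistinguishable_users (G w)]).
rewrite probability_setC ?indist_probE // indist_event.
exact: measurable_law (measurable_intersection hG) _.
Qed.

Lemma indist_prob_ge0 : 0 <= indist_prob.
Proof. by rewrite sumr_ge0 // => g _; exact: law_ge0. Qed.

Lemma indist_prob_le1 : indist_prob <= 1.
Proof.
rewrite -lee_fin -indist_probE probability_le1 // indist_event.
exact: measurable_law (measurable_intersection hG) _.
Qed.

Lemma indist_prob_le : (1 < n)%N ->
  indist_prob <= 4 * expR (- threshold n m p q).
Proof.
move=> n1; have := pr_has_indist_le (law_ge0 P G) (product_law_intersection hG).
move=> /le_trans; apply; rewrite expR_threshold ?(ltnW n1) //.
set a := agree 2 (p _ _); set b := agree 2 (q _ _).
have -> : a ^+ n = a ^+ 2 * a ^+ (n - 2) by rewrite -exprD; congr (_ ^+ _); lia.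
(* Having exponent [n - 2] in place of [n] costs [a ^- 2], at most 4 because [a] is at least 1/2. *)
have a4 : 1 <= 4 * a ^+ 2.
  have := agree2_ge (p true true); rewrite -/a => a2.
  have : 0 <= (2 * a - 1) * (2 * a + 1) by rewrite mulr_ge0; lra.
  by lra.
have z0 : 0 <= a ^+ (n - 2) * b ^+ m.
  by rewrite mulr_ge0 // exprn_ge0 // ltW // agree2_gt0.
have -> : 4 * (n%:R ^+ 2 * (a ^+ 2 * a ^+ (n - 2)) * b ^+ m)
    = n%:R ^+ 2 * (4 * a ^+ 2) * (a ^+ (n - 2) * b ^+ m) by ring.
apply: ler_wpM2r => //; apply: (@le_trans _ _ (n%:R ^+ 2)).
  by rewrite -natrX ler_nat; lia.
by rewrite ler_peMr // exprn_ge0.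
Qed.

Lemma indist_prob_ge : (3 < n)%N ->
  (agree 2 (p true true) ^- 4 + 8 * Num.sqrt (2 * expR (threshold n m p q))
    + 4 * expR (threshold n m p q))^-1 <= indist_prob.
Proof.
move=> n4; have p01 := probability_vector_bounds true true hp.
have q01 := probability_vector_bounds true true hq.
have n1 : (1 < n)%N by lia.
have := pr_has_indist_ge (law_ge0 P G) (product_law_intersection hG) p01 q01 n1.
apply: le_trans; apply: le_trans (moment_ratio_ge m n4 p01 q01).
rewrite -expR_threshold ?(ltnW n1) //.
by rewrite -expRN opprK.
Qed.

End OnePair.

(** * Passage to the limit *)

(** A squeeze: the lower bound tends to the inverse of [1 + 0 + 0]. Only real sequences appear, so
    the probability spaces varying with [n] are out of the way. *)
Lemma indist_prob_cvg1 (R : realType) (t a rho : nat -> R) :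
  t @ \oo --> -oo -> a @ \oo --> (1 : R) ->
  (forall n, rho n <= 1) ->
  (forall n, (3 < n)%N -> (a n ^- 4 + 8 * Num.sqrt (2 * expR (t n))
    + 4 * expR (t n))^-1 <= rho n) ->
  rho @ \oo --> (1 : R).
Proof.
move=> tNy a1 rho1 rho_ge.
have e0 : (fun n => expR (t n)) @ \oo --> (0 : R).
  have tNy' : (fun n => - t n) @ \oo --> +oo by apply/cvgNry.
  rewrite (_ : (fun n => _) = (fun x => expR (- x)) \o (fun n => - t n)).
    exact: cvg_comp tNy' (@cvgr_expR R).
  by apply/funext => n /=; rewrite opprK.
apply: (@squeeze_cvgr _ _ _ _ (fun n => (a n ^- 4
    + 8 * Num.sqrt (2 * expR (t n)) + 4 * expR (t n))^-1) (cst 1)); last exact: cvg_cst.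
- by near=> n; rewrite rho1 andbT; apply: rho_ge; near: n; exact: nbhs_infty_gt.
rewrite [X in _ --> X](_ : 1 = (1 ^- 4 + 8 * Num.sqrt (2 * 0) + 4 * 0)^-1); last first.
  by rewrite mulr0 sqrtr0 !mulr0 !addr0 expr1n !invr1.
apply: cvgV.
  by rewrite mulr0 sqrtr0 !mulr0 !addr0 expr1n !invr1 oner_neq0.
apply: cvgD; last by apply: cvgMr.
apply: cvgD.
  apply: cvgV; first by rewrite expr1n oner_neq0.
  apply: (@cvg_comp _ _ _ a (fun x => x ^+ 4) _ _ _ a1).
  exact: exprn_continuous.
apply: cvgMr.
apply: (@cvg_comp _ _ _ (fun n => 2 * expR (t n)) Num.sqrt); last exact: sqrt_continuous.
exact: cvgMr.
Unshelve. all: by end_near. Qed.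

Theorem lemma3 (R : realType)
    (d : nat -> measure_display) (T : forall n, measurableType (d n))
    (P : forall n, probability (T n) R)
    (m : nat -> nat) (p q : nat -> bool -> bool -> R)
    (G1 G2 : forall n, T n -> graph n (m n))
    (hp : forall n, probability_vector (p n))
    (hq : forall n, probability_vector (q n))
    (hG : forall n, attributed_ER_pair (P n) (p n) (q n) (G1 n) (G2 n))
    (hcor : forall n, positively_correlated_edges (P n) (G1 n) (G2 n)) :
  ((fun n => threshold n (m n) (p n) (q n)) @ \oo --> -oo ->
   (fun n => P n [set w | has_indistinguishable_users
                            (intersection_graph (G1 n w) (G2 n w))])
     @ \oo --> 1%E)
  /\
  ((fun n => threshold n (m n) (p n) (q n)) @ \oo --> +oo ->
   (fun n => P n [set w | ~ has_indistinguishable_users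
                            (intersection_graph (G1 n w) (G2 n w))])
     @ \oo --> 1%E).
Proof.
pose rho n : R := indist_prob (P n) (G1 n) (G2 n).
have p01 n := probability_vector_bounds true true (hp n).
have q01 n := probability_vector_bounds true true (hq n).
split=> t.
- under eq_fun => n do rewrite (indist_probE (hG n)).
  apply: cvg_EFin; first exact: nearW.
  apply: (indist_prob_cvg1 t (cvg_agree2 p01 q01 t)) => n.
    exact: indist_prob_le1 (hG n).
  exact: indist_prob_ge.
- under eq_fun => n do rewrite (indist_probNE (hG n)).
  apply: cvg_EFin; first exact: nearW.
  (* The first moment bound gives the lower side, which tends to 1 since [expR (- x)] vanishes at
     infinity. *)
  apply: (@squeeze_cvgr _ _ _ _
    (fun n => 1 - 4 * expR (- threshold n (m n) (p n) (q n))) (cst 1)).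
  + near=> n; apply/andP; split; last by rewrite gerBl indist_prob_ge0.
    rewrite lerD2l lerN2; apply: (indist_prob_le (hG n)).
    by near: n; exact: nbhs_infty_gt.
  + rewrite -[X in _ --> X]subr0 -[X in _ --> _ - X](mulr0 4).
    apply: cvgB; first exact: cvg_cst.
    apply: cvgMr; exact: cvg_comp _ _ t (@cvgr_expR R).
  + exact: cvg_cst.
Unshelve. all: by end_near. Qed.
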